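(* Let $T:\mathfrak{h}\to\mathfrak{g}$ be a homomorphic embedding tensor on a 3-Leibniz algebra $(\mathfrak{g},[\cdot,\cdot,\cdot]_{\mathfrak{g}})$ with respect to an action $(\mathfrak{h},[\cdot,\cdot,\cdot]_{\mathfrak{h}};\rho^l,\rho^m,\rho^r)$. Then $(\mathfrak{h},[\cdot,\cdot,\cdot]_{\mathfrak{h}},[\cdot,\cdot,\cdot]_{\vdash}^T,[\cdot,\cdot,\cdot]_{\perp}^T,[\cdot,\cdot,\cdot]_{\dashv}^T)$ is a 3-tri-Leibniz dialgebra, where $$[u,v,w]_{\vdash}^T=\rho^l(Tu,Tv,w),\quad [u,v,w]_{\perp}^T=\rho^m(Tu,v,Tw),\quad [u,v,w]_{\dashv}^T=\rho^r(u,Tv,Tw)$$ for all $u,v,w\in\mathfrak{h}$.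
   Context: All vector spaces and (multi)linear maps are over a field $\mathbb{K}$ of characteristic zero. 3-Leibniz algebra: a vector space $\mathfrak{g}$ with a trilinear map $[\cdot,\cdot,\cdot]_{\mathfrak{g}}:\mathfrak{g}\times\mathfrak{g}\times\mathfrak{g}\to\mathfrak{g}$ such that $[a,b,[x,y,z]]=[[a,b,x],y,z]+[x,[a,b,y],z]+[x,y,[a,b,z]]$ for all $a,b,x,y,z\in\mathfrak{g}$. A 3-Leibniz algebra homomorphism is a linear map preserving the brackets. Representation of $(\mathfrak{g},[\cdot,\cdot,\cdot]_{\mathfrak{g}})$: a vector space $V$ with trilinear maps $\rho^l:\mathfrak{g}\otimes\mathfrak{g}\otimes V\to V$, $\rho^m:\mathfrak{g}\otimes V\otimes\mathfrak{g}\to V$, $\rho^r:V\otimes\mathfrak{g}\otimes\mathfrak{g}\to V$ such that for all $x,y,z,a,b\in\mathfrak{g}$, $u\in V$ (brackets are those of $\mathfrak{g}$): $\rho^l(a,b,\rho^l(x,y,u))=\rho^l([a,b,x],y,u)+\rho^l(x,[a,b,y],u)+\rho^l(x,y,\rho^l(a,b,u))$; $\rho^l(a,b,\rho^m(x,u,z))=\rho^m([a,b,x],u,z)+\rho^m(x,\rho^l(a,b,u),z)+\rho^m(x,u,[a,b,z])$; $\rho^l(a,b,\rho^r(u,y,z))=\rho^r(\rho^l(a,b,u),y,z)+\rho^r(u,[a,b,y],z)+\rho^r(u,y,[a,b,z])$; $\rho^m(a,u,[x,y,z])=\rho^r(\rho^m(a,u,x),y,z)+\rho^m(x,\rho^m(a,u,y),z)+\rho^l(x,y,\rho^m(a,u,z))$;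 $\rho^r(u,b,[x,y,z])=\rho^r(\rho^r(u,b,x),y,z)+\rho^m(x,\rho^r(u,b,y),z)+\rho^l(x,y,\rho^r(u,b,z))$. Action: for a 3-Leibniz algebra $\mathfrak{h}$ and trilinear maps $\rho^l:\mathfrak{g}\otimes\mathfrak{g}\otimes\mathfrak{h}\to\mathfrak{h}$, $\rho^m:\mathfrak{g}\otimes\mathfrak{h}\otimes\mathfrak{g}\to\mathfrak{h}$, $\rho^r:\mathfrak{h}\otimes\mathfrak{g}\otimes\mathfrak{g}\to\mathfrak{h}$, $(\mathfrak{h},[\cdot,\cdot,\cdot]_{\mathfrak{h}};\rho^l,\rho^m,\rho^r)$ is an action of $\mathfrak{g}$ if $(\mathfrak{h};\rho^l,\rho^m,\rho^r)$ is a representation of $\mathfrak{g}$ and for all $a,b,x,y,z\in\mathfrak{g}$ and $s,u,v,w\in\mathfrak{h}$: $\rho^l(a,b,[u,v,w]_{\mathfrak{h}})=[\rho^l(a,b,u),v,w]_{\mathfrak{h}}+[u,\rho^l(a,b,v),w]_{\mathfrak{h}}+[u,v,\rho^l(a,b,w)]_{\mathfrak{h}}$; $[\rho^m(a,s,x),v,w]_{\mathfrak{h}}+[u,\rho^m(a,s,y),w]_{\mathfrak{h}}+[u,v,\rho^m(a,s,z)]_{\mathfrak{h}}=0$; $[\rho^r(s,a,x),v,w]_{\mathfrak{h}}+[u,\rho^r(s,a,y),w]_{\mathfrak{h}}+[u,v,\rho^r(s,a,z)]_{\mathfrak{h}}=0$; $\rho^l(a,b,[u,v,w]_{\mathfrak{h}})=[u,v,\rho^l(a,b,w)]_{\mathfrak{h}}$;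 $\rho^m(a,[u,v,w]_{\mathfrak{h}},b)=[u,v,\rho^m(a,w,b)]_{\mathfrak{h}}$; $\rho^r([u,v,w]_{\mathfrak{h}},a,b)=[u,v,\rho^r(w,a,b)]_{\mathfrak{h}}$. Embedding tensor on $\mathfrak{g}$ with respect to a representation $V$: a linear map $T:V\to\mathfrak{g}$ with $[Tu,Tv,Tw]_{\mathfrak{g}}=T\rho^l(Tu,Tv,w)=T\rho^m(Tu,v,Tw)=T\rho^r(u,Tv,Tw)$ for all $u,v,w\in V$. A homomorphic embedding tensor on $\mathfrak{g}$ with respect to an action $(\mathfrak{h},[\cdot,\cdot,\cdot]_{\mathfrak{h}};\rho^l,\rho^m,\rho^r)$ is a linear map $T:\mathfrak{h}\to\mathfrak{g}$ that is both an embedding tensor and a 3-Leibniz algebra homomorphism. 3-tri-Leibniz algebra: a vector space with three trilinear brackets $[\cdot,\cdot,\cdot]_{\dashv},[\cdot,\cdot,\cdot]_{\perp},[\cdot,\cdot,\cdot]_{\vdash}$ such that for all elements $x,y,z,a,b$ and all choices of $\triangle\in\{\vdash,\dashv,\perp\}$ (each occurrence of $\triangle$ may be chosen independently): (i) $[a,b,[x,y,z]_{\triangle}]_{\dashv}=[[a,b,x]_{\dashv},y,z]_{\dashv}+[x,[a,b,y]_{\dashv},z]_{\perp}+[x,y,[a,b,z]_{\dashv}]_{\vdash}$; (ii) $[a,b,[x,y,z]_{\dashv}]_{\vdash}=[[a,b,x]_{\vdash},y,z]_{\dashv}+[x,[a,b,y]_{\triangle},z]_{\dashv}+[x,y,[a,b,z]_{\triangle}]_{\dashv}$;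 (iii) $[a,b,[x,y,z]_{\vdash}]_{\vdash}=[[a,b,x]_{\triangle},y,z]_{\vdash}+[x,[a,b,y]_{\triangle},z]_{\vdash}+[x,y,[a,b,z]_{\vdash}]_{\vdash}$; (iv) $[a,b,[x,y,z]_{\perp}]_{\vdash}=[[a,b,x]_{\triangle},y,z]_{\perp}+[x,[a,b,y]_{\vdash},z]_{\perp}+[x,y,[a,b,z]_{\triangle}]_{\perp}$; (v) $[a,b,[x,y,z]_{\triangle}]_{\perp}=[[a,b,x]_{\perp},y,z]_{\dashv}+[x,[a,b,y]_{\perp},z]_{\perp}+[x,y,[a,b,z]_{\perp}]_{\vdash}$. 3-tri-Leibniz dialgebra: a tuple $(\mathfrak{k},[\cdot,\cdot,\cdot]_{\mathfrak{k}},[\cdot,\cdot,\cdot]_\vdash,[\cdot,\cdot,\cdot]_\dashv,[\cdot,\cdot,\cdot]_\perp)$ such that $(\mathfrak{k},[\cdot,\cdot,\cdot]_{\mathfrak{k}})$ is a 3-Leibniz algebra, $(\mathfrak{k},[\cdot,\cdot,\cdot]_\vdash,[\cdot,\cdot,\cdot]_\dashv,[\cdot,\cdot,\cdot]_\perp)$ is a 3-tri-Leibniz algebra, and for all $x,y,z,a,b\in\mathfrak{k}$ and $\triangle\in\{\vdash,\dashv,\perp\}$: $[a,b,[x,y,z]_{\mathfrak{k}}]_{\vdash}=[[a,b,x]_{\vdash},y,z]_{\mathfrak{k}}+[x,[a,b,y]_{\vdash},z]_{\mathfrak{k}}+[x,y,[a,b,z]_{\vdash}]_{\mathfrak{k}}$;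 $[[a,b,x]_{\perp},y,z]_{\mathfrak{k}}+[x,[a,b,y]_{\perp},z]_{\mathfrak{k}}+[x,y,[a,b,z]_{\perp}]_{\mathfrak{k}}=0$; $[[a,b,x]_{\dashv},y,z]_{\mathfrak{k}}+[x,[a,b,y]_{\dashv},z]_{\mathfrak{k}}+[x,y,[a,b,z]_{\dashv}]_{\mathfrak{k}}=0$; $[a,b,[x,y,z]_{\mathfrak{k}}]_{\vdash}=[x,y,[a,b,z]_{\vdash}]_{\mathfrak{k}}$; $[a,[x,y,z]_{\mathfrak{k}},b]_{\perp}=[x,y,[a,z,b]_{\perp}]_{\mathfrak{k}}$; $[[x,y,z]_{\mathfrak{k}},a,b]_{\dashv}=[x,y,[z,a,b]_{\dashv}]_{\mathfrak{k}}$; $[[x,y,z]_{\mathfrak{k}},a,b]_{\vdash}=[[x,y,z]_{\triangle},a,b]_{\vdash}$; $[a,[x,y,z]_{\mathfrak{k}},b]_{\vdash}=[a,[x,y,z]_{\triangle},b]_{\vdash}$; $[[x,y,z]_{\mathfrak{k}},a,b]_{\perp}=[[x,y,z]_{\triangle},a,b]_{\perp}$; $[a,b,[x,y,z]_{\mathfrak{k}}]_{\perp}=[a,b,[x,y,z]_{\triangle}]_{\perp}$; $[a,b,[x,y,z]_{\mathfrak{k}}]_{\dashv}=[a,b,[x,y,z]_{\triangle}]_{\dashv}$; $[a,[x,y,z]_{\mathfrak{k}},b]_{\dashv}=[a,[x,y,z]_{\triangle},b]_{\dashv}$. *)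

(* Defs.v *)
From HB Require Import structures.
From mathcomp Require Import all_boot all_order all_algebra.
Set Implicit Arguments.
Unset Strict Implicit.
Unset Printing Implicit Defensive.
Import GRing.Theory.
Local Open Scope ring_scope.

Definition trilinear (K : fieldType) (U V W X : lmodType K)
    (f : U -> V -> W -> X) : Prop :=
  [/\ forall v w, linear (fun u => f u v w),
      forall u w, linear (fun v => f u v w)
    & forall u v, linear (fun w => f u v w)].

Record leibniz3 (K : fieldType) (g : lmodType K) (br : g -> g -> g -> g)
    : Prop := Leibniz3 {
  leibniz3_trilinear : trilinear br;
  leibniz3_identity : forall a b x y z,
    br a b (br x y z) =
      br (br a b x) y z + br x (br a b y) z + br x y (br a b z)
}.

Definition leibniz3_hom (K : fieldType) (g h : lmodType K)
    (brg : g -> g -> g -> g) (brh : h -> h -> h -> h)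
    (f : {linear g -> h}) : Prop :=
  forall x y z, f (brg x y z) = brh (f x) (f y) (f z).

Record representation (K : fieldType) (g : lmodType K)
    (br : g -> g -> g -> g) (V : lmodType K)
    (rl : g -> g -> V -> V) (rm : g -> V -> g -> V) (rr : V -> g -> g -> V)
    : Prop := Representation {
  repr_l_trilinear : trilinear rl;
  repr_m_trilinear : trilinear rm;
  repr_r_trilinear : trilinear rr;
  repr_ll : forall a b x y u,
    rl a b (rl x y u) =
      rl (br a b x) y u + rl x (br a b y) u + rl x y (rl a b u);
  repr_lm : forall a b x u z,
    rl a b (rm x u z) =
      rm (br a b x) u z + rm x (rl a b u) z + rm x u (br a b z);
  repr_lr : forall a b u y z,
    rl a b (rr u y z) =
      rr (rl a b u) y z + rr u (br a b y) z + rr u y (br a b z);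
  repr_m : forall a u x y z,
    rm a u (br x y z) =
      rr (rm a u x) y z + rm x (rm a u y) z + rl x y (rm a u z);
  repr_r : forall u b x y z,
    rr u b (br x y z) =
      rr (rr u b x) y z + rm x (rr u b y) z + rl x y (rr u b z)
}.

Record action (K : fieldType) (g : lmodType K) (brg : g -> g -> g -> g)
    (h : lmodType K) (brh : h -> h -> h -> h)
    (rl : g -> g -> h -> h) (rm : g -> h -> g -> h) (rr : h -> g -> g -> h)
    : Prop := Action {
  action_leibniz3 : leibniz3 brh;
  action_representation : representation brg rl rm rr;
  action_l_derivation : forall a b u v w,
    rl a b (brh u v w) =
      brh (rl a b u) v w + brh u (rl a b v) w + brh u v (rl a b w);
  action_m_vanish : forall a s x y z u v w,
    brh (rm a s x) v w + brh u (rm a s y) w + brh u v (rm a s z) = 0;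
  action_r_vanish : forall s a x y z u v w,
    brh (rr s a x) v w + brh u (rr s a y) w + brh u v (rr s a z) = 0;
  action_l_bracket : forall a b u v w,
    rl a b (brh u v w) = brh u v (rl a b w);
  action_m_bracket : forall a b u v w,
    rm a (brh u v w) b = brh u v (rm a w b);
  action_r_bracket : forall a b u v w,
    rr (brh u v w) a b = brh u v (rr w a b)
}.

Definition embedding_tensor (K : fieldType) (g : lmodType K)
    (br : g -> g -> g -> g) (V : lmodType K)
    (rl : g -> g -> V -> V) (rm : g -> V -> g -> V) (rr : V -> g -> g -> V)
    (T : {linear V -> g}) : Prop :=
  forall u v w,
    [/\ br (T u) (T v) (T w) = T (rl (T u) (T v) w),
        T (rl (T u) (T v) w) = T (rm (T u) v (T w))
      & T (rm (T u) v (T w)) = T (rr u (T v) (T w))].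

Definition homomorphic_embedding_tensor (K : fieldType) (g : lmodType K)
    (brg : g -> g -> g -> g) (h : lmodType K) (brh : h -> h -> h -> h)
    (rl : g -> g -> h -> h) (rm : g -> h -> g -> h) (rr : h -> g -> g -> h)
    (T : {linear h -> g}) : Prop :=
  embedding_tensor brg rl rm rr T /\ leibniz3_hom brh brg T.

(* Labels of the three brackets of a 3-tri-Leibniz algebra. A quantified label
   plays the role of the symbol "triangle"; separate occurrences in one identity
   get separate labels since they may be chosen independently. *)
Inductive tri := Vdash | Dashv | Perp.

Record tri_leibniz3 (K : fieldType) (k : lmodType K)
    (br : tri -> k -> k -> k -> k) : Prop := TriLeibniz3 {
  tri_trilinear : forall t, trilinear (br t);
  tri_dashv : forall t a b x y z,
    br Dashv a b (br t x y z) =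
      br Dashv (br Dashv a b x) y z + br Perp x (br Dashv a b y) z
      + br Vdash x y (br Dashv a b z);
  tri_vdash_dashv : forall t1 t2 a b x y z,
    br Vdash a b (br Dashv x y z) =
      br Dashv (br Vdash a b x) y z + br Dashv x (br t1 a b y) z
      + br Dashv x y (br t2 a b z);
  tri_vdash_vdash : forall t1 t2 a b x y z,
    br Vdash a b (br Vdash x y z) =
      br Vdash (br t1 a b x) y z + br Vdash x (br t2 a b y) z
      + br Vdash x y (br Vdash a b z);
  tri_vdash_perp : forall t1 t2 a b x y z,
    br Vdash a b (br Perp x y z) =
      br Perp (br t1 a b x) y z + br Perp x (br Vdash a b y) z
      + br Perp x y (br t2 a b z);
  tri_perp : forall t a b x y z,
    br Perp a b (br t x y z) =
      br Dashv (br Perp a b x) y z + br Perp x (br Perp a b y) z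
      + br Vdash x y (br Perp a b z)
}.

Record tri_leibniz3_dialgebra (K : fieldType) (k : lmodType K)
    (brk : k -> k -> k -> k) (br : tri -> k -> k -> k -> k)
    : Prop := TriLeibniz3Dialgebra {
  dialg_leibniz3 : leibniz3 brk;
  dialg_tri_leibniz3 : tri_leibniz3 br;
  dialg_vdash_derivation : forall a b x y z,
    br Vdash a b (brk x y z) =
      brk (br Vdash a b x) y z + brk x (br Vdash a b y) z
      + brk x y (br Vdash a b z);
  dialg_perp_vanish : forall a b x y z,
    brk (br Perp a b x) y z + brk x (br Perp a b y) z
      + brk x y (br Perp a b z) = 0;
  dialg_dashv_vanish : forall a b x y z,
    brk (br Dashv a b x) y z + brk x (br Dashv a b y) z
      + brk x y (br Dashv a b z) = 0;
  dialg_vdash_bracket : forall a b x y z,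
    br Vdash a b (brk x y z) = brk x y (br Vdash a b z);
  dialg_perp_bracket : forall a b x y z,
    br Perp a (brk x y z) b = brk x y (br Perp a z b);
  dialg_dashv_bracket : forall a b x y z,
    br Dashv (brk x y z) a b = brk x y (br Dashv z a b);
  dialg_vdash1 : forall t a b x y z,
    br Vdash (brk x y z) a b = br Vdash (br t x y z) a b;
  dialg_vdash2 : forall t a b x y z,
    br Vdash a (brk x y z) b = br Vdash a (br t x y z) b;
  dialg_perp1 : forall t a b x y z,
    br Perp (brk x y z) a b = br Perp (br t x y z) a b;
  dialg_perp3 : forall t a b x y z,
    br Perp a b (brk x y z) = br Perp a b (br t x y z);
  dialg_dashv3 : forall t a b x y z,
    br Dashv a b (brk x y z) = br Dashv a b (br t x y z);
  dialg_dashv2 : forall t a b x y z,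
    br Dashv a (brk x y z) b = br Dashv a (br t x y z) b
}.

Definition induced_tri_bracket (K : fieldType) (g h : lmodType K)
    (rl : g -> g -> h -> h) (rm : g -> h -> g -> h) (rr : h -> g -> g -> h)
    (T : {linear h -> g}) (t : tri) (u v w : h) : h :=
  match t with
  | Vdash => rl (T u) (T v) w
  | Perp => rm (T u) v (T w)
  | Dashv => rr u (T v) (T w)
  end.

(* Main.v *)
Require Import Defs.
From mathcomp Require Import all_boot all_order all_algebra.
Import GRing.Theory.
Local Open Scope ring_scope.

(** The point is that [T] does not distinguish the brackets: an embedding tensor
    sends each of the three induced brackets of [u], [v], [w] to the single
    element [brg (T u) (T v) (T w)] (lemma [embedding_tensor_induced]), and a
    homomorphic one also sends [brh u v w] there.

    In an induced bracket every slot but one enters only through [T]. So an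
    inner bracket that stands in such a slot may be replaced by the bracket of
    [g]; this accounts for the freely chosen labels and for the six identities
    that exchange [brh] with an induced bracket. After the replacement, each
    3-tri-Leibniz identity is one of the five axioms of a representation
    evaluated at elements of the image of [T]
    (lemma [tri_leibniz3_induced]), and each remaining compatibility
    between [brh] and the induced brackets is an axiom of an action, evaluated
    in the same way. *)

Section EmbeddingTensor.

Set Implicit Arguments.
Unset Strict Implicit.

Lemma trilinear_comp (K : fieldType) (U V W U' V' W' X : lmodType K)
    (f : U -> V -> W -> X)
    (A : {linear U' -> U}) (B : {linear V' -> V}) (C : {linear W' -> W}) :
  trilinear f -> trilinear (fun u v w => f (A u) (B v) (C w)).
Proof.
case=> f1 f2 f3; split=> s t k p q; rewrite linearP.
- exact: f1.
- exact: f2.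
- exact: f3.
Qed.

Variables (K : fieldType) (g : lmodType K) (brg : g -> g -> g -> g).
Variables (V : lmodType K).
Variables (rl : g -> g -> V -> V) (rm : g -> V -> g -> V).
Variables (rr : V -> g -> g -> V) (T : {linear V -> g}).

Local Notation br := (induced_tri_bracket rl rm rr T).

Lemma embedding_tensor_induced (t : tri) (u v w : V) :
  embedding_tensor brg rl rm rr T ->
  T (br t u v w) = brg (T u) (T v) (T w).
Proof. by move=> /(_ u v w)[-> lm mr]; case: t; rewrite /= ?lm ?mr. Qed.

(** When the outer bracket is [Dashv] or [Perp], the inner bracket of [x], [y],
    [z] stands in a slot seen through [T], and the identity is [repr_r] or
    [repr_m]. When it is [Vdash], the identity says that the left action of
    [T a], [T b] is a derivation of [rr], [rl] or [rm]. *)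
Lemma tri_leibniz3_induced :
    representation brg rl rm rr -> embedding_tensor brg rl rm rr T ->
  tri_leibniz3 br.
Proof.
move=> R ET; have TE t u v w := embedding_tensor_induced t u v w ET.
split.
- case.
  + exact: (trilinear_comp T T idfun (repr_l_trilinear R)).
  + exact: (trilinear_comp idfun T T (repr_r_trilinear R)).
  + exact: (trilinear_comp T idfun T (repr_m_trilinear R)).
(* In all five identities the inner brackets that [T] is applied to are
   exactly those with a free label, so [TE] removes every free label. *)
- by move=> *; rewrite /= !TE; apply: (repr_r R).
- by move=> *; rewrite /= !TE; apply: (repr_lr R).
- by move=> *; rewrite /= !TE; apply: (repr_ll R).
- by move=> *; rewrite /= !TE; apply: (repr_lm R).
- by move=> *; rewrite /= !TE; apply: (repr_m R).
Qed.

End EmbeddingTensor.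

Theorem theorem4p6 (K : fieldType) (charK : [pchar K] =i pred0)
    (g : lmodType K) (brg : g -> g -> g -> g) (Lg : leibniz3 brg)
    (h : lmodType K) (brh : h -> h -> h -> h)
    (rl : g -> g -> h -> h) (rm : g -> h -> g -> h) (rr : h -> g -> g -> h)
    (act : action brg brh rl rm rr)
    (T : {linear h -> g})
    (HT : homomorphic_embedding_tensor brg brh rl rm rr T) :
  tri_leibniz3_dialgebra brh (induced_tri_bracket rl rm rr T).
Proof.
case: HT => ET homT.
have same_image t x y z :
    T (brh x y z) = T (induced_tri_bracket rl rm rr T t x y z).
  by rewrite homT (embedding_tensor_induced _ _ _ _ ET).
split.
- exact: action_leibniz3 act.
- exact: tri_leibniz3_induced (action_representation act) ET.
- by move=> *; apply: (action_l_derivation act).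
- by move=> *; apply: (action_m_vanish act).
- by move=> *; apply: (action_r_vanish act).
- by move=> *; apply: (action_l_bracket act).
- by move=> *; apply: (action_m_bracket act).
- by move=> *; apply: (action_r_bracket act).
- by move=> t a b x y z; congr (rl _ _ _); apply: same_image.
- by move=> t a b x y z; congr (rl _ _ _); apply: same_image.
- by move=> t a b x y z; congr (rm _ _ _); apply: same_image.
- by move=> t a b x y z; congr (rm _ _ _); apply: same_image.
- by move=> t a b x y z; congr (rr _ _ _); apply: same_image.
- by move=> t a b x y z; congr (rr _ _ _); apply: same_image.
Qed.
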